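(* Let $M=\Gamma(H\overrightarrow{\times}G,(1,0))$ be a strongly $(H,1)$-perfect pseudo MV-algebra with a square root $r$, where $(H,1)$ is a unital $\ell$-subgroup of $(\mathbb R,1)$ and $G$ is an $\ell$-group. Then $M$ satisfies precisely one of the following statements: (i) If $H\cong\mathbb Z$, then $|G|=1$ and $r(0)=0$. The converse holds, too. (ii) If $r$ is strict, then $H$ is two-divisible. The converse holds, too.
   Context: $\ell$-groups (lattice-ordered groups) are written additively and need not be Abelian. A unital $\ell$-group $(K,v)$ is an $\ell$-group $K$ with a fixed strong unit $v\ge 0$ (for each $g\in K$ there is an integer $n\ge1$ with $g\le nv$). $\Gamma(K,v)=([0,v];\oplus,^-,^\sim,0,v)$ with $x\oplus y=(x+y)\wedge v$, $x^-=v-x$, $x^\sim=-x+v$; in it $x\odot y:=(y^-\oplus x^-)^\sim=(x-v+y)\vee 0$, and the order is that of $K$. Pseudo MV-algebras are, up to isomorphism, exactly the algebras $\Gamma(K,v)$. Put $x\to y:=x^-\oplus y$, $x\rightsquigarrow y:=y\oplus x^\sim$. $H$ is a subgroup of $\mathbb R$ containing $1$; $H\overrightarrow{\times}G$ is the lexicographic product (the group $H\times G$ ordered lexicographically, first coordinate first), with strong unit $(1,0)$. The strongly $(H,1)$-perfect pseudo MV-algebras are exactly, up to isomorphism, the algebras $\Gamma(H\overrightarrow{\times}G,(1,0))$ with $G$ an $\ell$-group. In $r(0)$, $0$ denotes the least element $(0,0)$ of $M$. A square root on a pseudo MV-algebra $M$ is a map $r:M\to M$ such that (Sq1) $r(x)\odot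 r(x)=x$ for all $x$; (Sq2) $y\odot y\le x$ implies $y\le r(x)$; (Sq3) $r(x^-)=r(x)\to r(0)$ and $r(x^\sim)=r(x)\rightsquigarrow r(0)$ for all $x$. It is strict if $r(0)=r(0)^-$ (equivalently $r(0)=r(0)^\sim$). $H$ is two-divisible if for each $g\in H$ there is $h\in H$ with $2h=g$. *)

(* Defs.v *)
From HB Require Import structures.
From mathcomp Require Import all_boot all_order all_algebra.
From mathcomp Require Import reals.

Set Implicit Arguments.
Unset Strict Implicit.
Unset Printing Implicit Defensive.

Import Order.TTheory GRing.Theory Num.Theory.
Local Open Scope order_scope.

(* An l-group is a possibly noncommutative, possibly infinite group whose
   translations preserve a lattice order.  MathComp only has abelian additive
   groups, so l-groups are written multiplicatively: (x * y)%g, 1%g, x^-1%g and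
   (x ^+ n)%g stand for x + y, 0, - x and nx. *)
HB.mixin Record isLGroup d L of Order.Lattice d L & Group L := {
  leMgl : forall z x y : L, x <= y -> (z * x)%g <= (z * y)%g;
  leMgr : forall z x y : L, x <= y -> (x * z)%g <= (y * z)%g
}.

#[short(type="lgroupType")]
HB.structure Definition LGroup d :=
  {L of isLGroup d L & Order.Lattice d L & Group L}.

#[short(type="ogroupType")]
HB.structure Definition OGroup d :=
  {L of LGroup d L & Order.Total d L}.

Definition lgroup_iso d d' (K : lgroupType d) (L : lgroupType d') : Prop :=
  exists f : K -> L, [/\ bijective f,
    {morph f : x y / (x * y)%g},
    {morph f : x y / x `&` y} &
    {morph f : x y / x `|` y}].

Record unitalLGroup d := UnitalLGroup {
  ulg_sort :> lgroupType d;
  ulg_unit : ulg_sort;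
  ulg_unit_ge0 : 1%g <= ulg_unit;
  ulg_unit_strong :
    forall g : ulg_sort, exists2 n : nat, (0 < n)%N & g <= (ulg_unit ^+ n)%g
}.

(* Gamma(K, v) for a unital l-group (K, v).  In additive notation,
   Gamma_oplus x y is (x + y) /\ v, Gamma_lneg x is x^- = v - x, and
   Gamma_rneg x is x^~ = - x + v; Gamma_limp and Gamma_rimp are the
   implications x -> y = x^- (+) y and x ~> y = y (+) x^~. *)
Section Gamma.
Variables (d : Order.disp_t) (K : unitalLGroup d).
Local Notation v := (ulg_unit K).

Definition Gamma := {x : K | 1%g <= x <= v}.
Implicit Types x y : Gamma.

Definition Gamma_le x y : bool := val x <= val y.

Fact Gamma_zero_subproof : 1%g <= (1%g : K) <= v.
Proof. by rewrite lexx ulg_unit_ge0. Qed.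
Definition Gamma_zero : Gamma := exist _ 1%g Gamma_zero_subproof.

Fact Gamma_one_subproof : 1%g <= v <= v.
Proof. by rewrite lexx ulg_unit_ge0. Qed.
Definition Gamma_one : Gamma := exist _ v Gamma_one_subproof.

Fact Gamma_oplus_subproof x y : 1%g <= (val x * val y)%g `&` v <= v.
Proof.
case: x y => [x /andP[x0 _]] [y /andP[y0 _]] /=.
rewrite leIr lexI ulg_unit_ge0 !andbT (le_trans x0) //.
by rewrite -[leLHS]mulg1 leMgl.
Qed.
Definition Gamma_oplus x y : Gamma :=
  exist _ ((val x * val y)%g `&` v) (Gamma_oplus_subproof x y).

Fact Gamma_lneg_subproof x : 1%g <= (v / val x)%g <= v.
Proof.
case: x => [x /andP[x0 xv]] /=; apply/andP; split.
  by rewrite -(mulgV x) leMgr.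
by move: (leMgl (v / x)%g _ _ x0); rewrite mulg1 divgK.
Qed.
Definition Gamma_lneg x : Gamma :=
  exist _ (v / val x)%g (Gamma_lneg_subproof x).

Fact Gamma_rneg_subproof x : 1%g <= ((val x)^-1 * v)%g <= v.
Proof.
case: x => [x /andP[x0 xv]] /=; apply/andP; split.
  by rewrite -(mulVg x) leMgl.
by move: (leMgr (x^-1 * v)%g _ _ x0); rewrite mul1g mulVKg.
Qed.
Definition Gamma_rneg x : Gamma :=
  exist _ ((val x)^-1 * v)%g (Gamma_rneg_subproof x).

Definition Gamma_odot x y : Gamma :=
  Gamma_rneg (Gamma_oplus (Gamma_lneg y) (Gamma_lneg x)).

Definition Gamma_limp x y : Gamma := Gamma_oplus (Gamma_lneg x) y.
Definition Gamma_rimp x y : Gamma := Gamma_oplus y (Gamma_rneg x).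

Definition is_square_root (r : Gamma -> Gamma) : Prop :=
  [/\ forall x, Gamma_odot (r x) (r x) = x,
      forall x y, Gamma_le (Gamma_odot y y) x -> Gamma_le y (r x),
      forall x, r (Gamma_lneg x) = Gamma_limp (r x) (r Gamma_zero) &
      forall x, r (Gamma_rneg x) = Gamma_rimp (r x) (r Gamma_zero)].

Definition is_strict (r : Gamma -> Gamma) : Prop :=
  r Gamma_zero = Gamma_lneg (r Gamma_zero).

End Gamma.

(* On Zlgroup and rsubgroup, the group law _ * _ is the addition of numbers. *)
Definition Zlgroup : Type := int.

HB.instance Definition _ := Order.Total.on Zlgroup.
HB.instance Definition _ := Group.copy Zlgroup (Algebra.to_multiplicative int).

Fact Zlgroup_leMl (z x y : Zlgroup) : x <= y -> (z * x)%g <= (z * y)%g.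
Proof. by move=> xy; rewrite [_ <= _](@lerD2l int). Qed.

Fact Zlgroup_leMr (z x y : Zlgroup) : x <= y -> (x * z)%g <= (y * z)%g.
Proof. by move=> xy; rewrite [_ <= _](@lerD2r int). Qed.

HB.instance Definition _ :=
  isLGroup.Build ring_display Zlgroup Zlgroup_leMl Zlgroup_leMr.

Section RealSubgroup.
Variables (R : realType) (H : zmodClosed R).

Definition rsubgroup := {x : R | x \in H}.

HB.instance Definition _ := SubChoice.on rsubgroup.
HB.instance Definition _ := [SubChoice_isSubZmodule of rsubgroup by <:].
HB.instance Definition _ :=
  [SubChoice_isSubOrder of rsubgroup by <: with ring_display].
HB.instance Definition _ :=
  Group.copy rsubgroup (Algebra.to_multiplicative rsubgroup).

Fact rsubgroup_leMl (z x y : rsubgroup) : x <= y -> (z * x)%g <= (z * y)%g.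
Proof. by move=> xy; rewrite [_ <= _](@lerD2l R). Qed.

Fact rsubgroup_leMr (z x y : rsubgroup) : x <= y -> (x * z)%g <= (y * z)%g.
Proof. by move=> xy; rewrite [_ <= _](@lerD2r R). Qed.

HB.instance Definition _ :=
  isLGroup.Build ring_display rsubgroup rsubgroup_leMl rsubgroup_leMr.

Definition two_divisible : Prop :=
  forall g : rsubgroup, exists h : rsubgroup, (h *+ 2)%R = g.

End RealSubgroup.

Section LexProduct.
Variables (d d' : Order.disp_t) (H : ogroupType d) (G : lgroupType d').

Definition lexprod := (H *lexi[ring_display] G)%type.
Implicit Types x y z : lexprod.

HB.instance Definition _ := Order.POrder.on lexprod.

Definition lex_meet x y : lexprod :=
  if x.1 < y.1 then x else if y.1 < x.1 then y else (x.1, x.2 `&` y.2).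

Definition lex_join x y : lexprod :=
  if x.1 < y.1 then y else if y.1 < x.1 then x else (x.1, x.2 `|` y.2).

Lemma lex_leE x y : (x <= y) = (x.1 < y.1) || ((x.1 == y.1) && (x.2 <= y.2)).
Proof. by rewrite leEprodlexi; case: ltgtP. Qed.

Fact lex_meetP x y z : (x <= lex_meet y z) = (x <= y) && (x <= z).
Proof.
rewrite /lex_meet !lex_leE.
case: (ltgtP y.1 z.1) => [yz|zy|yz] /=.
- case: (ltgtP x.1 y.1) => [xy|yx|->] //=.
    by rewrite (lt_trans xy yz).
  by rewrite yz andbT.
- case: (ltgtP x.1 z.1) => [xz|zx|->] //=.
  + by rewrite (lt_trans xz zy).
  + by rewrite andbF.
  + by rewrite zy.
- by rewrite -yz; case: (ltgtP x.1 y.1) => //= _; rewrite lexI.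
Qed.

Fact lex_joinP x y z : (lex_join x y <= z) = (x <= z) && (y <= z).
Proof.
rewrite /lex_join !lex_leE.
case: (ltgtP x.1 y.1) => [xy|yx|xy] /=.
- case: (ltgtP y.1 z.1) => [yz|zy|<-] //=.
  + by rewrite (lt_trans xy yz).
  + by rewrite andbF.
  + by rewrite xy.
- case: (ltgtP x.1 z.1) => [xz|zx|<-] //=.
    by rewrite (lt_trans yx xz).
  by rewrite yx andbT.
- by rewrite -xy; case: (ltgtP x.1 z.1) => //= _; rewrite leUx.
Qed.

HB.instance Definition _ :=
  Order.POrder_MeetJoin_isLattice.Build ring_display lexprod
    lex_meetP lex_joinP.

Definition lex_mul x y : lexprod := ((x.1 * y.1)%g, (x.2 * y.2)%g).
Definition lex_inv x : lexprod := (x.1^-1%g, x.2^-1%g).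
Definition lex_id : lexprod := (1%g, 1%g).

Fact lex_mulA : associative lex_mul.
Proof. by move=> [a b] [c d1] [e f]; rewrite /lex_mul /= !mulgA. Qed.

Fact lex_mul1 : left_id lex_id lex_mul.
Proof. by move=> [a b]; rewrite /lex_mul /= !mul1g. Qed.

Fact lex_mulV : left_inverse lex_id lex_inv lex_mul.
Proof. by move=> [a b]; rewrite /lex_mul /= !mulVg. Qed.

Fact lex_1mul : right_id lex_id lex_mul.
Proof. by move=> [a b]; rewrite /lex_mul /= !mulg1. Qed.

Fact lex_Vmul : right_inverse lex_id lex_inv lex_mul.
Proof. by move=> [a b]; rewrite /lex_mul /= !mulgV. Qed.

HB.instance Definition _ :=
  isGroup.Build lexprod lex_mulA lex_mul1 lex_1mul lex_mulV lex_Vmul.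

Fact lex_leMl z x y : x <= y -> (z * x)%g <= (z * y)%g.
Proof.
rewrite !lex_leE /= => /orP[xy|/andP[/eqP -> xy]]; last first.
  by rewrite eqxx leMgl ?orbT.
by rewrite lt_neqAle leMgl ?(ltW xy) // (inj_eq (mulgI _)) (lt_eqF xy).
Qed.

Fact lex_leMr z x y : x <= y -> (x * z)%g <= (y * z)%g.
Proof.
rewrite !lex_leE /= => /orP[xy|/andP[/eqP -> xy]]; last first.
  by rewrite eqxx leMgr ?orbT.
by rewrite lt_neqAle leMgr ?(ltW xy) // (inj_eq (mulIg _)) (lt_eqF xy).
Qed.

HB.instance Definition _ :=
  isLGroup.Build ring_display lexprod lex_leMl lex_leMr.

End LexProduct.

Section LexUnital.
Variables (R : realType) (H : zmodClosed R) (H1 : 1%R \in H).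
Variables (d : Order.disp_t) (G : lgroupType d).

Definition lex_unit : lexprod (rsubgroup H) G :=
  (exist _ 1%R H1 : rsubgroup H, 1%g : G).

Fact lex_unit_ge0 : 1%g <= lex_unit.
Proof. by rewrite lex_leE /= ltEsub /= ltr01. Qed.

Fact lex_unit_strong (g : lexprod (rsubgroup H) G) :
  exists2 n : nat, (0 < n)%N & g <= (lex_unit ^+ n)%g.
Proof.
exists (Num.bound `|val g.1|%R).+1 => //.
have mulE n : val (lex_unit ^+ n)%g.1 = n%:R%R :> R.
  by elim: n => // n IHn; rewrite expgS mulrS -IHn.
rewrite lex_leE ltEsub mulE; apply/orP; left.
rewrite (le_lt_trans (ler_norm _)) // (lt_trans (archi_boundP _)) //.
by rewrite ltr_nat.
Qed.

Definition lex_unital : unitalLGroup ring_display :=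
  UnitalLGroup lex_unit_ge0 lex_unit_strong.

End LexUnital.

(* Main.v *)
Require Import Defs.
From HB Require Import structures.
From mathcomp Require Import all_boot all_order all_algebra.
From mathcomp Require Import boolp reals.
From mathcomp Require Import zify lra.

(** Write an element of M as (a, b), with a in H and b in G.  The unit (1, 0)
    is central, so squaring is explicit: (a, b) (.) (a, b) is the join of
    (2a - 1, 2b) with (0, 0) ([odot_self]).  In particular only elements with
    a > 1/2 have a square with positive first coordinate, and that coordinate
    is then 2a - 1.  Everything follows from whether H meets the open interval
    (0, 1).

    If it does, every x in H with 0 < x < 1 is the first coordinate of some
    element of M, whose root must have first coordinate (x + 1) / 2; so H is
    closed under these midpoints with 1.  Since x / 2 = 1 - ((1 - x) + 1) / 2,
    closure under midpoints gives closure under halving on (0, 1), hence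
    1/2 = (x + 1) / 2 - x / 2 is in H, and splitting off integer parts makes H
    two-divisible ([two_divisible_of_inner]).  Then (1/2, 0) is an element of M
    of square 0, so it lies below r(0), while r(0) (.) r(0) = 0 forces the
    opposite inequality; thus r(0) = (1/2, 0) and r is strict
    ([sqrt0_of_two_divisible]).

    If it does not, then H is the set of integers, M consists of the positive
    cone of G at first coordinate 0 and the negative cone at 1, and an element
    at first coordinate 0 can only be the square of another such element, all
    of which have square 0.  So G has no positive element but 0, is trivial,
    and r(0) = 0 ([trivial_of_gap]).

    The two cases exclude each other: two-divisibility is invariant under group
    isomorphisms and fails for the integers, and strictness puts the first
    coordinate 1/2 of r(0) in H.  In particular an H that is isomorphic to the
    integers, wherever its unit is sent, does not meet (0, 1). *)

Import Order.TTheory GRing.Theory Num.Theory.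
Local Open Scope order_scope.

(** * Inverses, joins and meets in an l-group *)

Section LGroupTheory.
Context {d : Order.disp_t} {K : lgroupType d}.
Implicit Types x y z : K.

Lemma leM2gr z x y : ((x * z)%g <= (y * z)%g) = (x <= y).
Proof.
apply/idP/idP=> [le_xz_yz|]; last exact: leMgr.
by rewrite -(mulgK z x) -(mulgK z y) leMgr.
Qed.

Lemma leM2gl z x y : ((z * x)%g <= (z * y)%g) = (x <= y).
Proof.
apply/idP/idP=> [le_zx_zy|]; last exact: leMgl.
by rewrite -(mulKg z x) -(mulKg z y) leMgl.
Qed.

Lemma leV2g x y : (x^-1%g <= y^-1%g) = (y <= x).
Proof. by rewrite -[LHS](leM2gl x) mulgV -[LHS](leM2gr y) mulgVK mul1g. Qed.

Lemma joinMg z x y : ((x `|` y) * z = (x * z) `|` (y * z))%g.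
Proof.
apply: le_anti; rewrite leUx !leMgr ?leUl ?leUr // andbT.
by rewrite -(leM2gr z^-1%g) mulgK leUx -!(leM2gr z _ (_ / z)%g) mulgVK leUl leUr.
Qed.

Lemma invg_meet x y : ((x `&` y)^-1 = x^-1 `|` y^-1)%g.
Proof.
apply: le_anti; rewrite leUx !leV2g leIl leIr !andbT.
by rewrite -leV2g invgK lexI -[_ <= x]leV2g -[_ <= y]leV2g invgK leUl leUr.
Qed.

(** An element x at least 1 satisfies x <= x * x, so its square can lie below 1
    only when x is 1. *)
Lemma sqrg_eq1_ge1 x : 1%g <= x -> (x * x)%g <= 1%g -> x = 1%g.
Proof.
move=> x_ge1 xx_le1; apply: le_anti; rewrite x_ge1 andbT.
by apply: le_trans xx_le1; rewrite -[leLHS]mulg1 leMgl.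
Qed.

Lemma trivial_of_positive_cone :
  (forall x, 1%g <= x -> x = 1%g) -> forall x, x = 1%g.
Proof.
move=> pos1; have le1 x : x <= 1%g.
  by rewrite -(pos1 (x `|` 1%g)) ?leUr ?leUl.
by move=> x; apply: le_anti; rewrite le1 -leV2g invg1 le1.
Qed.

End LGroupTheory.

(** By De Morgan, the negation of the meet defining the sum of negations becomes
    a join; this is the formula (x - v + y) \/ 0 for the product. *)
Lemma val_odot {d : Order.disp_t} (K : unitalLGroup d) (x y : Gamma K) :
  (val (Gamma_odot x y) = (val x / ulg_unit K * val y) `|` 1)%g.
Proof.
rewrite /= invg_meet joinMg mulVg invgM !invgF; congr (_ `|` _).
by rewrite -!mulgA mulVg mulg1.
Qed.

(** * Subgroups of the reals containing 1 *)

Section RealSubgroups.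
Context {R : realType} {H : zmodClosed R}.
Local Open Scope ring_scope.

(** Midpoints with 1 give halves by the reflection x |-> 1 - x, and one point c
    inside (0, 1) is enough to reach 1/2, which then halves the integer parts. *)
Lemma two_divisible_of_midpoints (c : R) :
    1 \in H -> c \in H -> 0 < c < 1 ->
    (forall x, x \in H -> 0 < x < 1 -> (x + 1) / 2 \in H) ->
  two_divisible H.
Proof.
move=> H1 Hc c01 midH.
have halfH x : x \in H -> 0 < x < 1 -> x / 2 \in H.
  move=> Hx x01; have -> : x / 2 = 1 - (1 - x + 1) / 2 by lra.
  by rewrite rpredB // midH ?rpredB //; lra.
have half1H : 1 / 2 \in H.
  have -> : 1 / 2 = (c + 1) / 2 - c / 2 :> R by lra.
  by rewrite rpredB ?midH ?halfH.
case=> x Hx; set n := Num.floor x; pose t := x - n%:~R.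
have Ht : t \in H by rewrite rpredB // rpredMz.
have /andP[t0 t1] : 0 <= t < 1.
  have := floor_le x; have := floorD1_gt x; rewrite intrD -/n /t; lra.
have Ht2 : t / 2 \in H.
  move: t0; rewrite le_eqVlt => /orP[/eqP <-|t0]; first by rewrite mul0r rpred0.
  by rewrite halfH // t0.
have Hx2 : x / 2 \in H.
  have -> : x / 2 = (1 / 2) *~ n + t / 2 by rewrite -mulrzl /t; lra.
  by rewrite rpredD // rpredMz.
by exists (exist _ (x / 2) Hx2); apply: val_inj; rewrite raddfMn /= mulr2n; lra.
Qed.

(** The fractional part of x lies in H and in [0, 1), so it can only be 0. *)
Lemma int_of_gap (x : R) :
    1 \in H -> (forall c, c \in H -> ~~ (0 < c < 1)) -> x \in H ->
  (Num.floor x)%:~R = x.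
Proof.
move=> H1 gapH Hx; set n := Num.floor x.
have Ht : x - n%:~R \in H by rewrite rpredB // rpredMz.
have := gapH _ Ht; have := floor_le x; have := floorD1_gt x.
rewrite intrD -/n; lra.
Qed.

Lemma iso_Z_of_gap :
    1 \in H -> (forall c, c \in H -> ~~ (0 < c < 1)) ->
  lgroup_iso (rsubgroup H) Zlgroup.
Proof.
move=> H1 gapH; pose f (x : rsubgroup H) : Zlgroup := Num.floor (val x).
have fK (x : rsubgroup H) : (f x : int)%:~R = val x.
  by apply: int_of_gap => //; apply: valP.
have Hint (n : int) : n%:~R \in H by rewrite rpredMz.
have le_f (x y : rsubgroup H) : (f x <= f y)%O = (x <= y)%O.
  by rewrite leEsub -!fK -(ler_int R).
exists f; split.
- pose g (n : Zlgroup) : rsubgroup H := exist _ ((n : int)%:~R : R) (Hint n).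
  exists g => [x|n].
    by apply: val_inj; apply: fK.
  exact: intrKfloor.
- move=> x y; apply: (@intr_inj R).
  by rewrite fK [RHS]intrD !fK.
- move=> x y; have [xy|/ltW yx] := leP x y.
    by rewrite (meet_l (y := f y)) ?le_f.
  by rewrite (meet_r (x := f x)) ?le_f.
- move=> x y; have [xy|/ltW yx] := leP x y.
    by rewrite (join_r (x := f x)) ?le_f.
  by rewrite (join_l (y := f y)) ?le_f.
Qed.

(** Half of the preimage of 1 would map to an integer k with k + k = 1. *)
Lemma iso_Z_not_two_divisible :
  lgroup_iso (rsubgroup H) Zlgroup -> ~ two_divisible H.
Proof.
case=> f [[g fK gK] fM _ _] /(_ (g (1 : int))) [h hE].
have : f (g (1 : int)) = (f h : int) + (f h : int) by rewrite -hE; apply: fM.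
rewrite gK; lia.
Qed.

End RealSubgroups.

(** * Squares and square roots in the interval of a lexicographic product *)

Section LexGamma.
Context {R : realType} {H : zmodClosed R} {H1 : 1%R \in H}.
Context {d : Order.disp_t} {G : lgroupType d}.
Local Notation K := (lex_unital H1 G).
Local Notation zero := (Gamma_zero K).
Implicit Types x y : Gamma K.
Local Open Scope ring_scope.

Definition level x : R := val (val x : lexprod (rsubgroup H) G).1.
Definition part x : G := (val x : lexprod (rsubgroup H) G).2.

Lemma level_part_inj x y : level x = level y -> part x = part y -> x = y.
Proof.
case: x y => [[h g] xP] [[h' g'] yP] /= eqh eqg; apply: val_inj => /=.
by congr (_, _) => //; apply: val_inj.
Qed.

Lemma Gamma_leE x y :
  Gamma_le x y =
  (level x < level y) || (level x == level y) && (part x <= part y)%O.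
Proof. by rewrite /Gamma_le lex_leE ltEsub. Qed.

Lemma level_in x : level x \in H.
Proof. exact: valP. Qed.

(** Squaring sends (a, b) to the join of (2a - 1, 2b) with 0, and a join in a
    lexicographic product is decided by the first coordinates unless they
    agree, hence the three cases around a = 1/2. *)
Lemma odot_self x :
  let xx := Gamma_odot x x in
  [/\ level x < 1 / 2 -> xx = zero,
      1 / 2 < level x ->
        level xx = 2 * level x - 1 /\ part xx = (part x * part x)%g &
      level x = 1 / 2 ->
        level xx = 0 /\ part xx = (part x * part x)%g `|` 1%g].
Proof.
set p : lexprod (rsubgroup H) G := (val x / ulg_unit K * val x)%g.
have p1 : val p.1 = 2 * level x - 1.
  by transitivity (level x - 1 + level x); last lra.
have p2 : p.2 = (part x * part x)%g by rewrite /= invg1 mulg1.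
have p1_lt0 : (p.1 < (1 : lexprod (rsubgroup H) G)%g.1)%O = (2 * level x - 1 < 0).
  by rewrite ltEsub p1.
have p1_gt0 : ((1 : lexprod (rsubgroup H) G)%g.1 < p.1)%O = (0 < 2 * level x - 1).
  by rewrite ltEsub p1.
have xxE : val (Gamma_odot x x) = lex_join p 1%g by rewrite val_odot.
have levelE : level (Gamma_odot x x) = val (lex_join p 1%g).1 by rewrite -xxE.
have partE : part (Gamma_odot x x) = (lex_join p 1%g).2 by rewrite -xxE.
move=> xx; rewrite {}/xx levelE partE; rewrite /lex_join p1_lt0 p1_gt0 in xxE *.
split=> xh.
- by apply: val_inj; rewrite xxE ifT //; lra.
- by rewrite ifF ?ifT ?p1 ?p2 //; lra.
- rewrite ifF ?ifF; [split|lra|lra]; last by rewrite -p2.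
  by transitivity (val p.1); last (rewrite p1; lra).
Qed.

Lemma Gamma_inner (c : R) (g : G) :
  c \in H -> 0 < c < 1 -> exists x, level x = c /\ part x = g.
Proof.
move=> Hc /andP[c0 c1]; pose y : lexprod (rsubgroup H) G := (exist _ c Hc, g).
have yP : (1%g <= y <= ulg_unit K)%O by rewrite !lex_leE !ltEsub /= c0 c1.
by exists (exist _ y yP).
Qed.

Lemma Gamma_bottom (g : G) :
  (1 <= g)%O%g -> exists x, level x = 0 /\ part x = g.
Proof.
move=> g1; pose y : lexprod (rsubgroup H) G := (1%g, g).
have yP : (1%g <= y <= ulg_unit K)%O.
  by rewrite !lex_leE !ltEsub /= ltxx eqxx g1 ltr01.
by exists (exist _ y yP).
Qed.

Lemma level_ge0 x : 0 <= level x.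
Proof.
have /andP[] := valP x; rewrite lex_leE ltEsub => x_ge0 _.
by case/orP: x_ge0 => [/ltW//|/andP[/eqP lvl _]]; rewrite /level -lvl.
Qed.

Variable r : Gamma K -> Gamma K.
Hypothesis r_sqrt : is_square_root r.

Lemma sqrt_sq x : Gamma_odot (r x) (r x) = x.
Proof. by case: r_sqrt. Qed.

Lemma sqrt_max x y : Gamma_odot y y = x -> Gamma_le y (r x).
Proof. by case: r_sqrt => _ + _ _ yx; apply; rewrite /Gamma_le yx. Qed.

(** An element of positive level is a nonzero square, so it falls under the
    branch of [odot_self] where the level of the square is 2a - 1. *)
Lemma level_sqrt x : 0 < level x -> level (r x) = (level x + 1) / 2.
Proof.
have [lo hi mid] := odot_self (r x); rewrite !sqrt_sq in lo hi mid.
move=> x0; have [/lo x_eq0|/hi[]|/mid[]] := ltgtP (level (r x)) (1 / 2).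
- by move: x0; rewrite x_eq0 ltxx.
- by move=> ->; lra.
- by move=> x_eq0; move: x0; rewrite x_eq0 ltxx.
Qed.

Lemma two_divisible_of_inner (c : R) :
  c \in H -> 0 < c < 1 -> two_divisible H.
Proof.
move=> Hc c01; apply: (two_divisible_of_midpoints _ H1 Hc c01) => x Hx x01.
have [y [y_x _]] := Gamma_inner _ 1%g Hx x01.
by rewrite -y_x -level_sqrt ?level_in // y_x; case/andP: x01.
Qed.

(** A root of level 1/2 is impossible in the absence of 1/2, and one of level
    above 1/2 has a square of positive level; below 1/2 all squares vanish. *)
Lemma sqrt_of_level0 x : (1 / 2 \notin H) -> level x = 0 ->
  x = zero /\ level (r x) < 1 / 2.
Proof.
move=> halfNH x0; have [lo hi _] := odot_self (r x).
rewrite !sqrt_sq in lo hi.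
have [r_lt|r_gt|r_eq] := ltgtP (level (r x)) (1 / 2); first by rewrite lo.
  by have [lvl _] := hi r_gt; exfalso; lra.
by move: (level_in (r x)); rewrite r_eq (negPf halfNH).
Qed.

(** Each g >= 0 in G gives an element (0, g) of level 0, which must vanish since
    it has a square root; and r(0) has a level below 1/2, hence 0. *)
Lemma trivial_of_gap : (forall c, c \in H -> ~~ (0 < c < 1)) ->
  (forall g : G, g = 1%g) /\ r zero = zero.
Proof.
move=> gapH; have halfNH : 1 / 2 \notin H.
  by apply/negP => /gapH /negP; apply; lra.
have G1 : forall g : G, g = 1%g.
  apply: trivial_of_positive_cone => g /Gamma_bottom[x [x0 <-]].
  by have [-> _] := sqrt_of_level0 _ halfNH x0.
split=> //; have [_ r0_lt] := sqrt_of_level0 zero halfNH erefl.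
apply: level_part_inj; last by rewrite [RHS]G1 [LHS]G1.
have := gapH _ (level_in (r zero)); have := level_ge0 (r zero).
have -> : level zero = 0 by [].
lra.
Qed.

(** The element (1/2, 0) has square 0, so maximality puts it below r(0); and
    r(0) cannot be larger because its own square is 0. *)
Lemma sqrt0_of_two_divisible : two_divisible H ->
  level (r zero) = 1 / 2 /\ part (r zero) = 1%g.
Proof.
move=> /(_ (exist _ 1 H1)) [[h Hh] /(congr1 val)]; rewrite raddfMn /= => hE.
have {hE}hE : h = 1 / 2 by move: hE; rewrite mulr2n; lra.
rewrite {}hE in Hh.
have [|y [y1 y2]] := Gamma_inner _ 1%g Hh; first lra.
have yy : Gamma_odot y y = zero.
  have [_ _ /(_ y1)[lvl prt]] := odot_self y.
  by apply: level_part_inj; rewrite ?lvl ?prt // y2 mulg1 joinxx.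
have := sqrt_max _ _ yy; rewrite Gamma_leE y1 y2.
have [_ hi mid] := odot_self (r zero); rewrite !sqrt_sq in hi mid.
have zero0 : level zero = 0 by [].
case: ltgtP => //= [r_gt _|/esym r_eq part_ge1].
  by have [lvl _] := hi r_gt; exfalso; lra.
split=> //; apply: sqrg_eq1_ge1 => //; have [_] := mid r_eq.
by rewrite -[part zero]/1%g => ->; rewrite leUl.
Qed.

Lemma level_lneg x : level (Gamma_lneg x) = 1 - level x.
Proof. by []. Qed.

Lemma part_lneg x : part (Gamma_lneg x) = (part x)^-1%g.
Proof. exact: mul1g. Qed.

End LexGamma.

Theorem proposition4p19
    (R : realType) (H : zmodClosed R) (H1 : 1%R \in H)
    (d : Order.disp_t) (G : lgroupType d)
    (r : Gamma (lex_unital H1 G) -> Gamma (lex_unital H1 G))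
    (r_sqrt : is_square_root r) :
  let zero := Gamma_zero (lex_unital H1 G) in
  let trivial_G := forall g : G, g = 1%g in
  let case_i := lgroup_iso (rsubgroup H) Zlgroup /\ trivial_G /\ r zero = zero in
  let case_ii := is_strict r /\ two_divisible H in
  [/\ lgroup_iso (rsubgroup H) Zlgroup <-> trivial_G /\ r zero = zero,
      is_strict r <-> two_divisible H,
      case_i \/ case_ii &
      ~ (case_i /\ case_ii)].
Proof.
move=> zero trivial_G case_i case_ii.
have strict_half : is_strict r -> level (r zero) = (1 / 2)%R.
  by move=> /(congr1 level); rewrite level_lneg => lvl; lra.
have half_strict : two_divisible H -> is_strict r.
  move=> /(sqrt0_of_two_divisible _ r_sqrt)[lvl prt]; apply: level_part_inj.
    by rewrite level_lneg lvl; lra.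
  by rewrite part_lneg prt invg1.
have [[c [Hc c01]]|gapH] :
    (exists c, c \in H /\ 0 < c < 1)%R \/ (forall c, c \in H -> ~~ (0 < c < 1)%R).
  have [inner|gap] := pselect (exists c, c \in H /\ 0 < c < 1)%R; first by left.
  by right=> c Hc; apply/negP => c01; apply: gap; exists c.
- have divH := two_divisible_of_inner _ r_sqrt _ Hc c01.
  have notZ : ~ lgroup_iso (rsubgroup H) Zlgroup.
    by move=> isoZ; apply: (iso_Z_not_two_divisible isoZ).
  have r0 : r zero <> zero.
    have [lvl _] := sqrt0_of_two_divisible _ r_sqrt divH.
    move/(congr1 level); rewrite lvl => half0.
    have {}half0 : (1 / 2 = 0 :> R)%R by rewrite half0.
    lra.
  split.
  + by split=> [/notZ|[_ /r0]].
  + by split=> // _; apply: half_strict.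
  + by right; split=> //; apply: half_strict.
  + by case=> [[/notZ]].
- have isoZ := iso_Z_of_gap H1 gapH.
  have caseI := trivial_of_gap _ r_sqrt gapH.
  have notdiv := iso_Z_not_two_divisible isoZ.
  have notstrict : ~ is_strict r.
    move=> /strict_half lvl; have := level_in (r zero); rewrite lvl => /gapH.
    by move/negP; apply; lra.
  split.
  + by split.
  + by split=> [/notstrict|/notdiv].
  + by left.
  + by case=> _ [/notstrict].
Qed.
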